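(* For every integer $m\ge 1$, the digraph ${\cal D}^*_m$ has exactly $2^m$ vertices; that is, every binary word of length $m$ is the outlet word $o(x)$ of some vertex $x$ of ${\cal D}_m$.
   Context: Alpha-letters (2-element subsets of the directions up, down, left, right): $a=\{\text{right},\text{down}\}$, $b=\{\text{up},\text{down}\}$, $c=\{\text{right},\text{up}\}$, $d=\{\text{left},\text{down}\}$, $e=\{\text{left},\text{right}\}$, $f=\{\text{left},\text{up}\}$. ${\cal D}_{ud}$: arc $(\alpha,\beta)$ iff ($\text{down}\in\alpha\iff\text{up}\in\beta$); ${\cal D}_{lr}$: arc $(\alpha,\beta)$ iff ($\text{right}\in\alpha\iff\text{left}\in\beta$). ${\cal D}_m$: vertices are the words $\alpha_1\cdots\alpha_m\in\{a,\dots,f\}^m$ with $(\alpha_i,\alpha_{i+1})$ an arc of ${\cal D}_{ud}$ for $1\le i\le m$ ($\alpha_{m+1}:=\alpha_1$); arc $v\to u$ iff $(v_i,u_i)$ is an arc of ${\cal D}_{lr}$ for all $i$. The outlet word $o(\alpha)\in\{0,1\}^m$ has $o_j=1$ iff $\alpha_j\in\{a,c,e\}$. ${\cal D}^*_m$ has vertex set $\{o(x):x\in V({\cal D}_m)\}$ (it is obtained from ${\cal D}_m$ by merging vertices with equal outlet words). *)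

(* Defs.v *)
From HB Require Import structures.
From mathcomp Require Import all_boot.

Set Implicit Arguments.
Unset Strict Implicit.
Unset Printing Implicit Defensive.

(* The arc relation is only meaningful between elements of [vertices]. *)
Record digraph (T : finType) := Digraph {
  vertices : {set T};
  arc : rel T
}.

Definition merge (T U : finType) (f : T -> U) (G : digraph T) : digraph U :=
  Digraph (f @: vertices G)
    [rel u v | [exists x in vertices G, exists y in vertices G,
                 [&& f x == u, f y == v & arc G x y]]].

Inductive direction := up | down | left | right.

Definition direction_code (x : direction) : bool * bool :=
  match x with
  | up => (false, false) | down => (false, true)
  | left => (true, false) | right => (true, true)
  end.

Definition direction_decode (c : bool * bool) : direction :=
  match c with
  | (false, false) => up | (false, true) => down
  | (true, false) => left | (true, true) => right
  end.

Lemma direction_codeK : cancel direction_code direction_decode.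
Proof. by case. Qed.

HB.instance Definition _ := Finite.copy direction (can_type direction_codeK).

Inductive letter := La | Lb | Lc | Ld | Le | Lf.

Definition letter_code (x : letter) : 'I_6 :=
  match x with
  | La => @Ordinal 6 0 isT | Lb => @Ordinal 6 1 isT | Lc => @Ordinal 6 2 isT
  | Ld => @Ordinal 6 3 isT | Le => @Ordinal 6 4 isT | Lf => @Ordinal 6 5 isT
  end.

Definition letter_decode (i : 'I_6) : letter :=
  nth La [:: La; Lb; Lc; Ld; Le; Lf] i.

Lemma letter_codeK : cancel letter_code letter_decode.
Proof. by case. Qed.

HB.instance Definition _ := Finite.copy letter (can_type letter_codeK).

Definition dirs (x : letter) : {set direction} :=
  match x with
  | La => [set right; down]
  | Lb => [set up; down]
  | Lc => [set right; up]
  | Ld => [set left; down]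
  | Le => [set left; right]
  | Lf => [set left; up]
  end.

Definition D_ud : digraph letter :=
  Digraph [set: letter] [rel x y | (down \in dirs x) == (up \in dirs y)].

Definition D_lr : digraph letter :=
  Digraph [set: letter] [rel x y | (right \in dirs x) == (left \in dirs y)].

(* [ordS] is the cyclic successor, so the last letter is followed by the
   first one. *)
Definition D (m : nat) : digraph (m.-tuple letter) :=
  Digraph
    [set w : m.-tuple letter |
       [forall i : 'I_m, arc D_ud (tnth w i) (tnth w (ordS i))]]
    [rel v u : m.-tuple letter |
       [forall i : 'I_m, arc D_lr (tnth v i) (tnth u i)]].

Definition outlet (m : nat) (w : m.-tuple letter) : m.-tuple bool :=
  [tuple tnth w j \in [:: La; Lc; Le] | j < m].

Definition Dstar (m : nat) : digraph (m.-tuple bool) :=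
  merge (@outlet m) (D m).

(* Main.v *)
Require Import Defs.
From mathcomp Require Import all_boot.

(** Seen along a column, a letter of outlet bit 1 is one of the pairs
    (up, down) in {01, 10, 00}, and a letter of outlet bit 0 one of
    {01, 10, 11}.  Hence letting the vertical bit alternate is compatible with
    every outlet word, and this closes up when m is even.  When m is odd, the
    first letter absorbs the parity defect: it is 00 or 11 according to its
    outlet bit. *)

(* The case [up = down = b], which no letter realizes, gets a junk value. *)
Definition letter_of (b u d : bool) : letter :=
  match b, u, d with
  | true, true, _ => Lc
  | true, false, true => La
  | true, false, false => Le
  | false, true, true => Lb
  | false, true, false => Lf
  | false, false, _ => Ld
  end.

Lemma outlet_letter_of b u d :
  (letter_of b u d \in [:: La; Lc; Le]) = b.
Proof. by case: b u d => [] [] []. Qed.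

Lemma up_letter_of b u d : (up \in dirs (letter_of b u d)) = u.
Proof. by case: b u d => [] [] []; rewrite !inE. Qed.

Lemma down_letter_of b u d :
  (u != d) || (u != b) -> (down \in dirs (letter_of b u d)) = d.
Proof. by case: b u d => [] [] [] //; rewrite !inE. Qed.

(** [k] numbers the boundary above letter [k]. The term [odd m] makes the values at [0] and [m]
    agree, so any defect of alternation falls between [0] and [1]. *)
Definition vertical_bit (b : bool) (m k : nat) : bool :=
  ~~ b (+) ((k != 0) && (odd k (+) odd m)).

Lemma vertical_bit_cyclic b m k :
  k < m -> vertical_bit b m (k.+1 %% m) = vertical_bit b m k.+1.
Proof.
rewrite leq_eqVlt => /predU1P[<-|lt_km]; last by rewrite modn_small.
by rewrite modnn /vertical_bit addbb andbF.
Qed.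

Lemma vertical_bit_step b m k :
  k != 0 -> vertical_bit b m k != vertical_bit b m k.+1.
Proof.
by case: k => // k _; rewrite /vertical_bit /=; case: b (odd k) (odd m) => [] [] [].
Qed.

Lemma vertical_bit0 b m : vertical_bit b m 0 != b.
Proof. by case: b. Qed.

Lemma outlet_surj m (w : m.-tuple bool) :
  exists2 x, x \in vertices (D m) & outlet x = w.
Proof.
(* The default [false] is reached only for [m = 0], when there are no letters. *)
pose v := vertical_bit (nth false w 0) m.
exists [tuple letter_of (tnth w i) (v i) (v i.+1) | i < m].
  rewrite inE; apply/forallP => i; rewrite /= !tnth_mktuple up_letter_of.
  rewrite down_letter_of ?[v (_ %% _)]vertical_bit_cyclic ?ltn_ord //.
  (* Letter [0] may have equal bits, but its up bit negates its outlet bit, which avoids the junk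
     case. *)
  have [i0 | /vertical_bit_step-> //] := eqVneq (val i) 0.
  by rewrite (tnth_nth false) i0 vertical_bit0 orbT.
by apply: eq_from_tnth => i; rewrite !tnth_mktuple outlet_letter_of.
Qed.

Theorem theorem3 (m : nat) (hm : 1 <= m) :
  #|vertices (Dstar m)| = 2 ^ m /\
  (forall w : m.-tuple bool, exists2 x, x \in vertices (D m) & outlet x = w).
Proof.
split; last exact: outlet_surj.
have -> : vertices (Dstar m) = [set: m.-tuple bool].
  apply/setP => w; rewrite inE; have [x Dx <-] := @outlet_surj m w.
  exact: imset_f.
by rewrite cardsT card_tuple card_bool.
Qed.
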